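(* Let $p$ be a prime and let $(A,+,\cdot)$ be a pre-Lie algebra over $\mathbb{F}_p$ with $(A,+)\cong C_p^5$, generated by a single element $x$ as a pre-Lie algebra. Suppose $A^{[6]}\neq 0$, $A^{[7]}=0$ and $A^{[5]}\neq A^{[4]}$. Then the following hold. (1) The elements $x,\ x^2,\ x^2\cdot x,\ (x^2\cdot x)\cdot x,\ x^2\cdot((x^2\cdot x)\cdot x)$ form a basis of $A$ as an $\mathbb{F}_p$-vector space. (2) $x\cdot x^2\in A^{[4]}$. (3) $x\cdot(x\cdot x^2)\in A^{[5]}$, $(x\cdot x^2)\cdot x\in A^{[5]}$, and $x\cdot(x^2\cdot x)-(x^2\cdot x)\cdot x\in A^{[5]}$. (4) In $A^{[5]}$ the following identities hold: $$x\cdot((x^2\cdot x)\cdot x)=x\cdot(x\cdot(x^2\cdot x)),\qquad ((x^2\cdot x)\cdot x)\cdot x=(x\cdot(x^2\cdot x))\cdot x,$$ $$x\cdot((x\cdot x^2)\cdot x)=x\cdot(x\cdot(x\cdot x^2))=((x\cdot x^2)\cdot x)\cdot x=(x\cdot(x\cdot x^2))\cdot x=0,$$ $$(x^2\cdot x^2)\cdot x=2\,((x^2\cdot x)\cdot x)\cdot x,\qquad x\cdot(x^2\cdot x^2)=2\,x\cdot((x^2\cdot x)\cdot x),$$ $$x^2\cdot(x\cdot x^2)=(x^2\cdot x)\cdot x^2+x\cdot(x^2\cdot x^2).$$ (5) $A^{[6]}=A^{[5]}=\mathbb{F}_p\,x^2\cdot((x^2\cdot x)\cdot x)$, $A^{[4]}/A^{[5]}=\mathbb{F}_p\,(x^2\cdot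 x)\cdot x$, and $A^{[3]}/A^{[4]}=\mathbb{F}_p\,(x^2\cdot x)$.
   Context: A pre-Lie algebra over $\mathbb{F}_p$ is an $\mathbb{F}_p$-vector space $A$ with a bilinear product $\cdot$ satisfying $(a\cdot b)\cdot c-a\cdot(b\cdot c)=(b\cdot a)\cdot c-b\cdot(a\cdot c)$ for all $a,b,c\in A$. For subspaces $B,C\subseteq A$, $B\cdot C$ denotes the subspace spanned by all $b\cdot c$ with $b\in B$, $c\in C$. Define $A^{[1]}=A$ and $A^{[i+1]}=\sum_{j=1}^{i}A^{[j]}\cdot A^{[i+1-j]}$ for $i\ge 1$. Write $x^2=x\cdot x$. For $a\in A$, $A^{[i]}=\mathbb{F}_p\,a$ means $A^{[i]}$ is spanned by $a$, and $A^{[i]}/A^{[j]}=\mathbb{F}_p\,a$ means the quotient is spanned by the image of $a\in A^{[i]}$. *)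

(* Defs.v *)
From HB Require Import structures.
From mathcomp Require Import all_boot all_order all_algebra.

Set Implicit Arguments.
Unset Strict Implicit.
Unset Printing Implicit Defensive.

Import GRing.Theory.
Local Open Scope ring_scope.

Reserved Notation "a ⋅ b" (at level 40, left associativity).

HB.mixin Record Vector_isPreLie (K : fieldType) A of Vector K A := {
  premul : A -> A -> A;
  premul_bilinear : bilinear_for *:%R *:%R premul;
  premul_pre_lie : forall a b c : A,
    premul (premul a b) c - premul a (premul b c) =
    premul (premul b a) c - premul b (premul a c)
}.

#[short(type="preLieVectType")]
HB.structure Definition PreLie (K : fieldType) :=
  {A of Vector K A & Vector_isPreLie K A}.

Notation "a ⋅ b" := (premul a b) : ring_scope.

Section PreLieTheory.
Variables (K : fieldType) (A : preLieVectType K).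
Implicit Types (a b c u v : A) (B C U V W : {vspace A}) (i j n : nat).

HB.instance Definition _ :=
  bilinear_isBilinear.Build K A A A *:%R *:%R (@premul K A) premul_bilinear.

(* The subspace B ⋅ C. It is enough to span it by the products of basis
   vectors, as for [prodv]: see [mem_premulv] and [premulvP]. *)
Definition premulv B C : {vspace A} :=
  <<[seq b ⋅ c | b <- vbasis B, c <- vbasis C]>>%VS.

Lemma mem_premulv B C : {in B & C, forall b c, b ⋅ c \in premulv B C}.
Proof.
move=> b c /coord_vbasis-> /coord_vbasis->.
rewrite linear_sumlz; apply: memv_suml => i _.
rewrite linear_sumr; apply: memv_suml => j _.
rewrite linearZl_LR linearZr_LR !memvZ // memv_span //.
by apply/allpairsP; exists ((vbasis B)`_i, (vbasis C)`_j); rewrite !memt_nth.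
Qed.

Lemma premulvP B C W :
  reflect {in B & C, forall b c, b ⋅ c \in W} (premulv B C <= W)%VS.
Proof.
apply: (iffP idP) => [sBCW b c Bb Cc | sBCW].
  by rewrite (subvP sBCW) ?mem_premulv.
apply/span_subvP=> _ /allpairsP[[b c] /= [Bb Cc ->]].
by rewrite sBCW ?vbasis_mem.
Qed.

(* [prelie_pow i] is A^[i], for i >= 1; the first argument of
   [prelie_pow_rec] is only recursion fuel, and A^[0] is a junk value.
   The defining equations are [prelie_pow1] and [prelie_powS]. *)
Fixpoint prelie_pow_rec n i : {vspace A} :=
  if n is n'.+1 then
    if (i <= 1)%N then fullv
    else (\sum_(1 <= j < i)
            premulv (prelie_pow_rec n' j) (prelie_pow_rec n' (i - j)))%VS
  else fullv.

Definition prelie_pow i : {vspace A} := prelie_pow_rec i i.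

Lemma prelie_pow1 : prelie_pow 1 = fullv.
Proof. by []. Qed.

Lemma prelie_pow_recE n i : (i <= n)%N -> prelie_pow_rec n i = prelie_pow i.
Proof.
rewrite /prelie_pow; elim/ltn_ind: n i => -[|n] IHn [|i] //= le_in.
case: ifP => // _; rewrite big_nat_cond [RHS]big_nat_cond.
apply: eq_bigr => j; rewrite andbT => /andP[j_gt0 j_le].
have h1 : (j <= i)%N by [].
have h2 : (i.+1 - j <= i)%N by rewrite leq_subLR -addn1 addnC leq_add2r.
by rewrite !(IHn n) ?(IHn i) ?(leq_trans h1) ?(leq_trans h2).
Qed.

Lemma prelie_powS i : (1 <= i)%N ->
  prelie_pow i.+1 =
    (\sum_(1 <= j < i.+1) premulv (prelie_pow j) (prelie_pow (i.+1 - j)))%VS.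
Proof.
move=> i_gt0; rewrite {1}/prelie_pow /= ltnNge i_gt0 /=.
rewrite big_nat_cond [RHS]big_nat_cond.
apply: eq_bigr => j; rewrite andbT => /andP[j_gt0 j_le].
by rewrite !prelie_pow_recE // leq_subLR -addn1 addnC leq_add2r.
Qed.

(* The only pre-Lie subalgebra containing x is A itself. *)
Definition prelie_generated_by (x : A) : Prop :=
  forall U, x \in U -> {in U &, forall u v, u ⋅ v \in U} -> U = fullv.

(* U / V = K a, for V <= U: a lies in U and its image spans the quotient. *)
Definition quotient_line U V a : Prop :=
  [/\ (V <= U)%VS, a \in U &
      {in U, forall u, exists k : K, u - k *: a \in V}].

End PreLieTheory.

Arguments prelie_pow {K} A i.

(* Main.v *)
Require Import Defs.
From HB Require Import structures.
From mathcomp Require Import all_boot all_order all_algebra.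

Set Implicit Arguments.
Unset Strict Implicit.
Unset Printing Implicit Defensive.

Import GRing.Theory.
Local Open Scope ring_scope.

(** Write x2 = x ⋅ x, a = x ⋅ x2, b = x2 ⋅ x and A^i for the i-th power of A.

    In low degrees a one-generated pre-Lie algebra satisfies
    A^(n+1) = A ⋅ A^n + A^n ⋅ A: the only product not visibly of this form,
    x2 ⋅ x2, is rewritten by the pre-Lie identity ([powS_subv_side]). Hence
    an equality A^(n+1) = A^n with n <= 3 would propagate up to A^5 = A^4,
    which is excluded. The powers A^1 > ... > A^5 are thus strictly decreasing,
    A^6 is nonzero, and dim A = 5 leaves only one possibility: all
    these steps have dimension one and A^6 = A^5 is a line ([pow_dims]).

    Since A^7 = 0, the equality A^5 = A^6 makes A^5 annihilate A on both
    sides. In degree 6 most terms of the pre-Lie identity therefore vanish, and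
    what is left is, for w in A^4 and v in A^3,
      w ⋅ x2 = 0,  v ⋅ a = 0,  v ⋅ b = x2 ⋅ (v ⋅ x),
      x2 ⋅ (x ⋅ v) = b ⋅ v - a ⋅ v.
    These relations show that A^6 would vanish if all products of two elements
    of A^3 did ([pow3_mul_pow3_neq0]). As a and b span A^3 modulo A^4 and
    A^3 ⋅ a = 0, this forces b ∉ A^4 and b ⋅ b <> 0 ([bb_neq0]). Now a is
    congruent to k *: b modulo A^4 for some scalar k, and
    0 = b ⋅ a = k *: (b ⋅ b) gives k = 0, that is a ∈ A^4. Then x2 ⋅ (b ⋅ x)
    and x2 ⋅ (x ⋅ b) are both equal to b ⋅ b, which spans A^6; as A^4 / A^5 is a
    line, x ⋅ b and b ⋅ x agree modulo A^5. The remaining identities follow,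
    since multiplication by x does not see A^5. *)

(** * Powers of a pre-Lie algebra *)
Section LowerSeries.
Variables (K : fieldType) (A : preLieVectType K).
Local Notation P := (prelie_pow A).

Lemma premulDl (u v w : A) : (u + v) ⋅ w = u ⋅ w + v ⋅ w.
Proof. exact: linearDl. Qed.

Lemma premulDr (u v w : A) : u ⋅ (v + w) = u ⋅ v + u ⋅ w.
Proof. exact: linearDr. Qed.

Lemma premulZl k (u v : A) : (k *: u) ⋅ v = k *: (u ⋅ v).
Proof. exact: linearZl_LR. Qed.

Lemma premulZr k (u v : A) : u ⋅ (k *: v) = k *: (u ⋅ v).
Proof. exact: linearZr_LR. Qed.

Lemma premulBl (u v w : A) : (u - v) ⋅ w = u ⋅ w - v ⋅ w.
Proof. exact: linearBl. Qed.

Lemma premulBr (u v w : A) : u ⋅ (v - w) = u ⋅ v - u ⋅ w.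
Proof. exact: linearBr. Qed.

(** With this instance the left annihilation condition u ⋅ v = 0 on v cuts out
    a subspace, the kernel of [linfun (premul u)], so that it need only be
    checked on products spanning a power of A. *)
Fact premul_is_linear (u : A) : linear (premul u).
Proof. by move=> k v w; rewrite premulDr premulZr. Qed.

HB.instance Definition _ (u : A) :=
  GRing.isLinear.Build K A A *:%R (premul u) (premul_is_linear u).

Lemma mem_pow_mul i j (u v : A) : (0 < i)%N -> (0 < j)%N ->
  u \in P i -> v \in P j -> u ⋅ v \in P (i + j).
Proof.
case: i => // i _; case: j => // j _ ui vj.
rewrite addSn prelie_powS ?addnS //
  (bigD1_seq i.+1) ?iota_uniq ?mem_index_iota //=; last first.
  by rewrite !ltnS leq_addr.
apply: subvP (addvSl _ _) _ _; apply: mem_premulv => //.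
by rewrite !subSS subSn ?leq_addr // addKn.
Qed.

Lemma mem_premul_l i u c : u \in P i.+1 -> c ⋅ u \in P i.+2.
Proof.
have cP : c \in P 1 by rewrite (prelie_pow1 A) memvf.
exact: (@mem_pow_mul 1 i.+1 _ _ isT isT cP).
Qed.

Lemma mem_premul_r i u c : u \in P i.+1 -> u ⋅ c \in P i.+2.
Proof.
have cP : c \in P 1 by rewrite (prelie_pow1 A) memvf.
by move=> ui; rewrite -[i.+2]addn1; exact: (@mem_pow_mul i.+1 1 _ _ isT isT ui cP).
Qed.

Lemma powS_subv i (W : {vspace A}) : (0 < i)%N ->
  (forall j (u v : A), (0 < j <= i)%N -> u \in P j -> v \in P (i.+1 - j) ->
    u ⋅ v \in W) ->
  (P i.+1 <= W)%VS.
Proof.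
move=> i0 H; rewrite prelie_powS // big_nat_cond.
elim/big_ind: _ => [|U V UW VW|j]; first exact: sub0v.
  by rewrite subv_add UW.
by rewrite andbT ltnS => hj; apply/premulvP => u v uj vj; apply: H hj uj vj.
Qed.

(** The powers are not defined as a descending sequence: in a product of
    A^j ⋅ A^(i+1-j), one factor that is not of degree 1 is lowered by
    induction, the left one as soon as j > 1. *)
Lemma powS_decr i : (0 < i)%N -> (P i.+1 <= P i)%VS.
Proof.
elim/ltn_ind: i => -[|[|i]] // IH _; first exact: subvf.
apply: powS_subv => // -[|[|j]] u v // /andP[_ jle] uj vj.
  have vj' : v \in P i.+1 by apply: (subvP (IH i.+1 _ _)); rewrite // -[i.+2]subn1.
  exact: mem_pow_mul uj vj'.
have uj' : u \in P j.+1 by apply: (subvP (IH j.+1 _ _)).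
have -> : i.+2 = (j.+1 + (i.+3 - j.+2))%N.
  by rewrite !subSS addSn subnKC // ltnW.
by apply: mem_pow_mul => //; rewrite !subSS subn_gt0.
Qed.

Lemma pow_decr i j : (0 < i <= j)%N -> (P j <= P i)%VS.
Proof.
case/andP=> i0; elim: j => [|j IH]; first by rewrite leqNgt i0.
rewrite leq_eqVlt ltnS => /predU1P[<- // | ij].
exact: subv_trans (powS_decr (leq_trans i0 ij)) (IH ij).
Qed.

Lemma quotient_line_add (U V : {vspace A}) a :
  quotient_line U V a -> forall u, u \in U ->
  exists k v, v \in V /\ u = k *: a + v.
Proof.
move=> [_ _ H] u /H[k uk]; exists k, (u - k *: a); split=> //.
by rewrite addrC subrK.
Qed.

Lemma quotient_line_subv (U V W : {vspace A}) a :
  quotient_line U V a -> a \in W -> (V <= W)%VS -> (U <= W)%VS.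
Proof.
move=> UVa aW VW; apply/subvP => u /(quotient_line_add UVa)[k [v [Vv ->]]].
by rewrite memvD ?memvZ // (subvP VW).
Qed.

(** A codimension of at most one leaves no room between V and <[a]> + V. *)
Lemma quotient_line_dim (U V : {vspace A}) a : (V <= U)%VS ->
  (\dim U <= (\dim V).+1)%N -> a \in U -> a \notin V -> quotient_line U V a.
Proof.
move=> VU dU aU aV; split=> // u uU.
have a0 : a != 0 by apply: contraNneq aV => ->; apply: mem0v.
have cap0 : (<[a]> :&: V = 0)%VS.
  apply/eqP; rewrite -subv0; apply/subvP => w /memv_capP[/vlineP[k ->]].
  rewrite rpredZeq (negPf aV) orbF => /eqP->; by rewrite scale0r mem0v.
have : (<[a]> + V)%VS == U.
  rewrite eqEdim subv_add -memvE aU VU /=.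
  by rewrite dimv_disjoint_sum // dim_vline a0 add1n.
move/eqP => E; move: uU; rewrite -E => /memv_addP[_ /vlineP[k ->] [v Vv ->]].
by exists k; rewrite addrAC subrr add0r.
Qed.

(** * One generator *)
Section Generator.
Variable x : A.
Hypothesis x_gen : prelie_generated_by x.
Local Notation x2 := (x ⋅ x).

Lemma sqr_mem : x2 \in P 2.
Proof. by apply: (@mem_premul_l 0); rewrite prelie_pow1 memvf. Qed.

(** <[x]> + A^2 is a subalgebra, because it contains every product. *)
Lemma quotient_line12 : quotient_line (P 1) (P 2) x.
Proof.
split=> [||u _]; rewrite ?prelie_pow1 ?subvf ?memvf //.
have E : (<[x]> + P 2)%VS = fullv.
  apply: x_gen => [|a b _ _].
    exact: subvP (addvSl _ _) _ (memv_line x).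
  by apply: subvP (addvSr _ _) _ _; apply: (@mem_pow_mul 1 1); rewrite // memvf.
move: (memvf u); rewrite -E => /memv_addP[_ /vlineP[k ->] [v Vv ->]].
by exists k; rewrite addrAC subrr add0r.
Qed.

Lemma quotient_line23 : quotient_line (P 2) (P 3) x2.
Proof.
have sP : (P 2 <= <[x2]> + P 3)%VS.
  apply: powS_subv => // -[|[|j]] u v // _.
  move=> /(quotient_line_add quotient_line12)[k [r [r2 ->]]].
  move=> /(quotient_line_add quotient_line12)[l [s [s2 ->]]].
  rewrite premulDl premulZl premulDr premulZr scalerDr -addrA.
  rewrite memv_add //; first by rewrite !memvZ // memv_line.
  rewrite memvD ?memvZ //; first by apply: (@mem_pow_mul 1 2); rewrite // memvf.
  by apply: (@mem_pow_mul 2 1); rewrite // memvf.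
split=> [||u /(subvP sP) /memv_addP[_ /vlineP[k ->] [v Vv ->]]].
- exact: powS_decr.
- exact: sqr_mem.
by exists k; rewrite addrAC subrr add0r.
Qed.

(** The symmetry of the associator in x2 and x, applied to x: it trades
    A^2 ⋅ A^2 for products with a factor in A. *)
Lemma sqr_mul_sqr : x2 ⋅ x2 = (x2 ⋅ x) ⋅ x - (x ⋅ x2) ⋅ x + x ⋅ (x2 ⋅ x).
Proof.
by rewrite -[LHS](subKr ((x2 ⋅ x) ⋅ x)) premul_pre_lie opprB addrA addrAC.
Qed.

(** A^(n+1) is spanned by A ⋅ A^n and A^n ⋅ A. For n <= 2 there are no other
    products; for n = 3 there is also A^2 ⋅ A^2, which modulo A^2 ⋅ A^3 and
    A^3 ⋅ A^2 reduces to x2 ⋅ x2, a case of [sqr_mul_sqr]. *)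
Lemma powS_subv_side n (W : {vspace A}) : (0 < n <= 3)%N ->
  (forall c v : A, v \in P n -> c ⋅ v \in W /\ v ⋅ c \in W) ->
  (P n.+1 <= W)%VS.
Proof.
move=> n3 H; apply: powS_subv; first by case/andP: n3.
case: n n3 H => [|[|[|[|n]]]] // _ H [|[|[|[|j]]]] u v //= _ ui vi.
- exact: (H u v vi).1.
- exact: (H u v vi).1.
- exact: (H v u ui).2.
- exact: (H u v vi).1.
- have [k [r [r3 ->]]] := quotient_line_add quotient_line23 ui.
  have [l [s [s3 ->]]] := quotient_line_add quotient_line23 vi.
  have x3 := mem_premul_r x sqr_mem.
  have x3' := mem_premul_l x sqr_mem.
  rewrite premulDl premulDr memvD //; last exact: (H _ r r3).2.
  rewrite memvD ?(H _ s s3).1 //.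
  rewrite premulZl premulZr; do 2!apply: memvZ.
  rewrite sqr_mul_sqr memvD ?memvB //.
  + exact: (H _ _ x3).2.
  + exact: (H _ _ x3').2.
  + exact: (H _ _ x3).1.
- exact: (H v u ui).2.
Qed.

(** An equality of two successive powers propagates by one step only because
    [powS_subv_side] expresses each power through the preceding one; for n = 5
    this fails in the algebras considered below, where A^6 = A^5 and A^7 = 0. *)
Lemma pow_stable n : (0 < n <= 3)%N ->
  P n.+1 = P n -> P n.+2 = P n.+1.
Proof.
move=> n3 E; have n0 : (0 < n)%N by case/andP: n3.
apply/eqP; rewrite eqEsubv powS_decr //=.
apply: powS_subv_side => // c v; rewrite -E => vn; split.
  by apply: (@mem_pow_mul 1); rewrite // memvf.
by rewrite -[n.+2]addn1; apply: mem_pow_mul; rewrite // memvf.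
Qed.

(** * Dimension five *)
Section Dimension5.
Hypotheses (dimA : \dim {:A} = 5%N) (A6_neq0 : P 6 <> 0%VS).
Hypotheses (A7_eq0 : P 7 = 0%VS) (A5_neqA4 : P 5 <> P 4).

(** The strict steps bound the dimensions of A^5, A^4, A^3 from above starting
    from dim A = 5, and from below starting from A^6 <> 0. *)
Lemma pow_dims :
  [/\ P 6 = P 5, \dim (P 5) = 1%N, \dim (P 4) = 2%N & \dim (P 3) = 3%N].
Proof.
have N3 : P 4 <> P 3 by move/(@pow_stable 3 isT).
have N2 : P 3 <> P 2 by move/(@pow_stable 2 isT).
have N1 : P 2 <> P 1 by move/(@pow_stable 1 isT).
have lt n : (0 < n)%N -> P n.+1 <> P n -> (\dim (P n.+1) < \dim (P n))%N.
  move=> n0 N; rewrite ltnNge; apply/negP => d; apply: N; apply/eqP.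
  by rewrite eqEdim powS_decr.
have d2 : (\dim (P 2) <= 4)%N.
  by rewrite -ltnS -dimA -(prelie_pow1 A); exact: lt N1.
have d3 : (\dim (P 3) <= 3)%N by exact: leq_trans (lt 2%N isT N2) d2.
have d4 : (\dim (P 4) <= 2)%N by exact: leq_trans (lt 3%N isT N3) d3.
have d5 : (\dim (P 5) <= 1)%N by exact: leq_trans (lt 4%N isT A5_neqA4) d4.
have d6 : (0 < \dim (P 6))%N by rewrite lt0n dimv_eq0; apply/eqP.
have E : P 6 = P 5.
  by apply/eqP; rewrite eqEdim (@powS_decr 5 isT); exact: leq_trans d5 d6.
have g5 : (0 < \dim (P 5))%N by rewrite -E.
have g4 := leq_ltn_trans g5 (lt 4%N isT A5_neqA4).
have g3 := leq_ltn_trans g4 (lt 3%N isT N3).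
split; first exact: E.
- by apply/eqP; rewrite eqn_leq d5.
- by apply/eqP; rewrite eqn_leq d4.
- by apply/eqP; rewrite eqn_leq d3.
Qed.

Local Notation a := (x ⋅ x2).
Local Notation b := (x2 ⋅ x).

Lemma a_mem3 : a \in P 3.
Proof. exact: mem_premul_l x sqr_mem. Qed.

Lemma b_mem3 : b \in P 3.
Proof. exact: mem_premul_r x sqr_mem. Qed.

Lemma quotient_line34 v : v \in P 3 -> v \notin P 4 -> quotient_line (P 3) (P 4) v.
Proof.
have [_ _ d4 d3] := pow_dims.
by apply: quotient_line_dim; rewrite ?d3 ?d4 ?powS_decr.
Qed.

Lemma quotient_line45 w : w \in P 4 -> w \notin P 5 -> quotient_line (P 4) (P 5) w.
Proof.
have [_ d5 d4 _] := pow_dims.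
by apply: quotient_line_dim; rewrite ?d5 ?d4 ?powS_decr.
Qed.

Lemma pow_mul_eq0 i j (u v : A) : (0 < i)%N -> (0 < j)%N -> (6 < i + j)%N ->
  u \in P i -> v \in P j -> u ⋅ v = 0.
Proof.
move=> i0 j0 ij ui vj; apply/eqP; rewrite -memv0 -A7_eq0.
exact: subvP (@pow_decr 7 _ ij) _ (mem_pow_mul i0 j0 ui vj).
Qed.

(** A^5 = A^6 has weight 6, so its products with A lie in A^7. *)
Lemma pow5_mul0 (u w : A) : w \in P 5 -> u ⋅ w = 0 /\ w ⋅ u = 0.
Proof.
have [<- _ _ _] := pow_dims => w6; have uP : u \in P 1.
  by rewrite (prelie_pow1 A) memvf.
split; first exact: (@pow_mul_eq0 1 6 _ _ isT isT isT uP w6).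
exact: (@pow_mul_eq0 6 1 _ _ isT isT isT w6 uP).
Qed.

(** In the pre-Lie identity for (w, x, x) every term but w ⋅ x2 has a
    factor in A^5. *)
Lemma pow4_mul_sqr w : w \in P 4 -> w ⋅ x2 = 0.
Proof.
move=> w4; have := premul_pre_lie w x x.
have [xw wx] := (mem_premul_l x w4, mem_premul_r x w4).
rewrite (pow5_mul0 x xw).2 (pow5_mul0 x wx).1 (pow5_mul0 x wx).2 sub0r subr0.
by move/eqP; rewrite oppr_eq0 => /eqP.
Qed.

(** The pre-Lie identity for (v, x, x2), with [pow4_mul_sqr] for v ⋅ x and x ⋅ v. *)
Lemma pow3_mul_a v : v \in P 3 -> v ⋅ a = 0.
Proof.
move=> v3; have := premul_pre_lie v x x2.
rewrite (pow4_mul_sqr (mem_premul_r x v3))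
  (pow4_mul_sqr (mem_premul_l x v3)) !sub0r => /oppr_inj ->.
exact: (pow5_mul0 x (@mem_pow_mul 3 2 _ _ isT isT v3 sqr_mem)).1.
Qed.

(** The pre-Lie identity for (v, x2, x); v ⋅ x2 and x2 ⋅ v lie in A^5. *)
Lemma pow3_mul_b v : v \in P 3 -> v ⋅ b = x2 ⋅ (v ⋅ x).
Proof.
move=> v3; have := premul_pre_lie v x2 x.
rewrite (pow5_mul0 x (@mem_pow_mul 3 2 _ _ isT isT v3 sqr_mem)).2.
rewrite (pow5_mul0 x (@mem_pow_mul 2 3 _ _ isT isT sqr_mem v3)).2.
by rewrite !sub0r => /oppr_inj.
Qed.

(** The pre-Lie identity for (x, x2, v). *)
Lemma sqr_mul_xv v : v \in P 3 -> x2 ⋅ (x ⋅ v) = b ⋅ v - a ⋅ v.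
Proof.
move=> v3; have := premul_pre_lie x x2 v.
rewrite (pow5_mul0 x (@mem_pow_mul 2 3 _ _ isT isT sqr_mem v3)).1 subr0 => ->.
by rewrite opprB addrCA subrr addr0.
Qed.

(** As A^5 annihilates A, the power A^6 is generated by A^2 ⋅ A^4, A^3 ⋅ A^3
    and A^4 ⋅ A^2. The last one is 0 by [pow4_mul_sqr], and x2 ⋅ A^4 is
    expressed through products of elements of A^3 by [pow3_mul_b] and
    [sqr_mul_xv]. *)
Lemma pow3_mul_pow3_neq0 : ~ {in P 3 &, forall v v', v ⋅ v' = 0}.
Proof.
move=> vv0; apply: A6_neq0; apply/eqP; rewrite -subv0.
have [a3 b3] := (a_mem3, b_mem3).
have x2w : {in P 4, forall w, x2 ⋅ w = 0}.
  suff /subvP L : (P 4 <= lker (linfun (premul x2)))%VS.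
    by move=> w /L; rewrite memv_ker lfunE => /eqP.
  apply: (@powS_subv_side 3 _ isT) => c v v3; rewrite 2!memv_ker !lfunE /=.
  have /(quotient_line_add quotient_line12)[k [r [r2 ->]]] : c \in P 1.
    by rewrite (prelie_pow1 A) memvf.
  rewrite premulDl !premulDr !premulZl !premulZr.
  rewrite (sqr_mul_xv v3) -(pow3_mul_b v3)
    (vv0 b v b3 v3) (vv0 a v a3 v3) (vv0 v b v3 b3).
  rewrite (pow5_mul0 x2 (@mem_pow_mul 2 3 _ _ isT isT r2 v3)).1.
  rewrite (pow5_mul0 x2 (@mem_pow_mul 3 2 _ _ isT isT v3 r2)).1.
  rewrite subr0 !scaler0 !addr0 !eqxx; split; exact: isT.
apply: (@powS_subv 5 _ isT) => -[|[|[|[|[|[|j]]]]]] u v hj ui vi; rewrite memv0.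
- discriminate hj.
- by rewrite (pow5_mul0 u vi).1.
- have [k [r [r3 ->]]] := quotient_line_add quotient_line23 ui.
  by rewrite premulDl premulZl (x2w v vi) scaler0 add0r
    (@pow_mul_eq0 3 4 _ _ isT isT isT r3 vi).
- by rewrite (vv0 u v ui vi).
- have [k [r [r3 ->]]] := quotient_line_add quotient_line23 vi.
  by rewrite premulDr premulZr (pow4_mul_sqr ui) scaler0 add0r
    (@pow_mul_eq0 4 3 _ _ isT isT isT ui r3).
- by rewrite (pow5_mul0 v ui).2.
- discriminate hj.
Qed.

(** Modulo A^4, which A^3 annihilates, A^3 is spanned by a and b, and
    [pow3_mul_a] deals with a. *)
Lemma pow3_mul_pow3_eq0 : {in P 3, forall v, v ⋅ b = 0} ->
  {in P 3 &, forall v v', v ⋅ v' = 0}.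
Proof.
move=> vb0 v v' v3.
have subK : (P 3 <= lker (linfun (premul v)))%VS.
  apply: (@powS_subv_side 2 _ isT) => c u u2; rewrite 2!memv_ker !lfunE /=.
  have /(quotient_line_add quotient_line12)[k [r [r2 ->]]] : c \in P 1.
    by rewrite (prelie_pow1 A) memvf.
  rewrite premulDl !premulDr !premulZl !premulZr.
  rewrite (@pow_mul_eq0 3 4 _ _ isT isT isT v3 (@mem_pow_mul 2 2 _ _ isT isT r2 u2)).
  rewrite (@pow_mul_eq0 3 4 _ _ isT isT isT v3 (@mem_pow_mul 2 2 _ _ isT isT u2 r2)).
  have [l [s [s3 ->]]] := quotient_line_add quotient_line23 u2.
  rewrite premulDl !premulDr !premulZl !premulZr.
  rewrite (@pow_mul_eq0 3 4 _ _ isT isT isT v3 (mem_premul_l x s3)).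
  rewrite (@pow_mul_eq0 3 4 _ _ isT isT isT v3 (mem_premul_r x s3)).
  rewrite (pow3_mul_a v3) (vb0 v v3) !scaler0 !addr0 !scaler0 !eqxx.
  split; exact: isT.
by move/(subvP subK); rewrite memv_ker lfunE => /eqP.
Qed.

(** Otherwise A^3 ⋅ b = 0, against [pow3_mul_pow3_neq0]: if b ∈ A^4 this is a
    matter of degree, and if not then b spans A^3 modulo A^4. *)
Lemma bb_neq0 : b ⋅ b != 0.
Proof.
have bP4 : b \notin P 4.
  apply/negP => b4; apply/pow3_mul_pow3_neq0/pow3_mul_pow3_eq0 => v v3.
  exact: (@pow_mul_eq0 3 4 _ _ isT isT isT v3 b4).
apply/eqP => bb0; apply/pow3_mul_pow3_neq0/pow3_mul_pow3_eq0 => v v3.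
have [k [w [w4 ->]]] := quotient_line_add (quotient_line34 b_mem3 bP4) v3.
by rewrite premulDl premulZl bb0
  (@pow_mul_eq0 4 3 _ _ isT isT isT w4 b_mem3) scaler0 addr0.
Qed.

Lemma b_notin4 : b \notin P 4.
Proof.
apply/negP => b4; case/eqP: bb_neq0.
exact: (@pow_mul_eq0 3 4 _ _ isT isT isT b_mem3 b4).
Qed.

(** Modulo A^4, a is a multiple k *: b, and k = 0 since b ⋅ a = 0 while
    b ⋅ b <> 0. *)
Lemma a_mem4 : a \in P 4.
Proof.
have [k [w [w4 E]]] := quotient_line_add (quotient_line34 b_mem3 b_notin4) a_mem3.
have /eqP := pow3_mul_a b_mem3.
rewrite E premulDr premulZr (@pow_mul_eq0 3 4 _ _ isT isT isT b_mem3 w4) addr0.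
by rewrite scaler_eq0 (negPf bb_neq0) orbF => /eqP ->; rewrite scale0r add0r.
Qed.

Lemma sqr_mul_bx : x2 ⋅ (b ⋅ x) = b ⋅ b.
Proof. by rewrite (pow3_mul_b b_mem3). Qed.

Lemma sqr_mul_xb : x2 ⋅ (x ⋅ b) = b ⋅ b.
Proof.
by rewrite (sqr_mul_xv b_mem3) (@pow_mul_eq0 4 3 _ _ isT isT isT a_mem4 b_mem3) subr0.
Qed.

Lemma bx_notin5 : b ⋅ x \notin P 5.
Proof.
apply/negP => bx5; case/eqP: bb_neq0.
by rewrite -sqr_mul_bx (pow5_mul0 x2 bx5).1.
Qed.

(** Multiplication by x2 on the left embeds the line A^4 / A^5 into A^6, and
    takes the same value b ⋅ b at x ⋅ b and b ⋅ x. *)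
Lemma xb_sub_bx_mem5 : x ⋅ b - b ⋅ x \in P 5.
Proof.
have [k [w [w5 E]]] :=
  quotient_line_add (quotient_line45 (mem_premul_r x b_mem3) bx_notin5)
    (mem_premul_l x b_mem3).
have := sqr_mul_xb; rewrite E premulDr premulZr sqr_mul_bx (pow5_mul0 x2 w5).1 addr0.
(* Comparing values at x ⋅ b = k *: (b ⋅ x) + w gives (k - 1) *: (b ⋅ b) = 0. *)
move/eqP; rewrite -subr_eq0 -{2}[b ⋅ b]scale1r -scalerBl scaler_eq0.
rewrite (negPf bb_neq0) orbF subr_eq0 => /eqP ->.
by rewrite scale1r addrAC subrr add0r.
Qed.

Lemma pow5_line : P 5 = <[b ⋅ b]>%VS.
Proof.
have [E d5 _ _] := pow_dims.
apply/eqP; rewrite eq_sym eqEdim dim_vline bb_neq0 d5 andbT -memvE -E.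
exact: (@mem_pow_mul 3 3 _ _ isT isT b_mem3 b_mem3).
Qed.

Lemma gen_basis : basis_of fullv [:: x; x2; b; b ⋅ x; x2 ⋅ (b ⋅ x)].
Proof.
rewrite basisEdim dimA andbT -(prelie_pow1 A).
have S (z : A) : z \in [:: x; x2; b; b ⋅ x; x2 ⋅ (b ⋅ x)] ->
  z \in <<[:: x; x2; b; b ⋅ x; x2 ⋅ (b ⋅ x)]>>%VS by exact: memv_span.
apply: (quotient_line_subv quotient_line12); first by apply: S; rewrite !inE eqxx.
apply: (quotient_line_subv quotient_line23).
  by apply: S; rewrite !inE eqxx ?orbT.
apply: (quotient_line_subv (quotient_line34 b_mem3 b_notin4)).
  by apply: S; rewrite !inE eqxx ?orbT.
apply: (quotient_line_subv (quotient_line45 (mem_premul_r x b_mem3) bx_notin5)).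
  by apply: S; rewrite !inE eqxx ?orbT.
by rewrite pow5_line -sqr_mul_bx -memvE; apply: S; rewrite !inE eqxx ?orbT.
Qed.

Lemma mul_x_congr (u v : A) : u - v \in P 5 -> x ⋅ u = x ⋅ v /\ u ⋅ x = v ⋅ x.
Proof.
move=> uv; have [] := pow5_mul0 x uv; rewrite premulBl premulBr.
by move=> /subr0_eq -> /subr0_eq ->; split; reflexivity.
Qed.

End Dimension5.
End Generator.
End LowerSeries.

(** Every scalar of 'F_p is a multiple of 1, so additive maps are linear. *)
Lemma dim_additive_Fp (p n : nat) (V : vectType 'F_p) :
  (exists f : {additive V -> 'rV['F_p]_n}, bijective f) -> \dim {:V} = n.
Proof.
case=> f f_bij.
have f_lin : linear f.
  move=> k u v; rewrite raddfD /=; congr (_ + _).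
  by rewrite -[k]natr_Zp !scaler_nat raddfMn.
pose g : {linear V -> 'rV['F_p]_n} :=
  HB.pack (f : V -> _) (GRing.isLinear.Build _ _ _ _ _ f_lin).
have kerg : (lker (linfun g) == 0)%VS.
  by apply/lker0P => u v; rewrite !lfunE => /(bij_inj f_bij).
have limg_g : limg (linfun g) = fullv.
  case: f_bij => h _ hK; apply/eqP; rewrite eqEsubv subvf /=.
  apply/subvP => w _; apply/memv_imgP; exists (h w); first exact: memvf.
  by rewrite (lfunE g) /= hK.
have := limg_dim_eq (f := linfun g) (U := fullv).
rewrite (eqP kerg) capv0 limg_g => /(_ erefl) <-.
by rewrite dimvf /dim /= mul1n.
Qed.

(** * The theorem *)
Theorem theorem4p2p2 (p : nat) (p_prime : prime p)
    (A : preLieVectType 'F_p)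
    (A_iso : exists f : {additive A -> 'rV['F_p]_5}, bijective f)
    (x : A) (x_gen : prelie_generated_by x)
    (A6_neq0 : prelie_pow A 6 <> 0%VS)
    (A7_eq0 : prelie_pow A 7 = 0%VS)
    (A5_neqA4 : prelie_pow A 5 <> prelie_pow A 4) :
  let x2 := x ⋅ x in
  (* (1) *)
  basis_of fullv
    [:: x; x2; x2 ⋅ x; (x2 ⋅ x) ⋅ x; x2 ⋅ ((x2 ⋅ x) ⋅ x)] /\
  (* (2) *)
  x ⋅ x2 \in prelie_pow A 4 /\
  (* (3) *)
  [/\ x ⋅ (x ⋅ x2) \in prelie_pow A 5,
      (x ⋅ x2) ⋅ x \in prelie_pow A 5 &
      x ⋅ (x2 ⋅ x) - (x2 ⋅ x) ⋅ x \in prelie_pow A 5] /\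
  (* (4) *)
  [/\ x ⋅ ((x2 ⋅ x) ⋅ x) = x ⋅ (x ⋅ (x2 ⋅ x)) /\
      ((x2 ⋅ x) ⋅ x) ⋅ x = (x ⋅ (x2 ⋅ x)) ⋅ x,
      [/\ x ⋅ ((x ⋅ x2) ⋅ x) = 0,
          x ⋅ (x ⋅ (x ⋅ x2)) = 0,
          ((x ⋅ x2) ⋅ x) ⋅ x = 0 &
          (x ⋅ (x ⋅ x2)) ⋅ x = 0],
      (x2 ⋅ x2) ⋅ x = (((x2 ⋅ x) ⋅ x) ⋅ x) *+ 2,
      x ⋅ (x2 ⋅ x2) = (x ⋅ ((x2 ⋅ x) ⋅ x)) *+ 2 &
      x2 ⋅ (x ⋅ x2) = (x2 ⋅ x) ⋅ x2 + x ⋅ (x2 ⋅ x2)] /\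
  (* (5) *)
  [/\ prelie_pow A 6 = prelie_pow A 5,
      prelie_pow A 5 = <[x2 ⋅ ((x2 ⋅ x) ⋅ x)]>%VS,
      quotient_line (prelie_pow A 4) (prelie_pow A 5) ((x2 ⋅ x) ⋅ x) &
      quotient_line (prelie_pow A 3) (prelie_pow A 4) (x2 ⋅ x)].
Proof.
have dimA : \dim {:A} = 5%N by exact: dim_additive_Fp.
move=> x2.
have a4 := a_mem4 x_gen dimA A6_neq0 A7_eq0 A5_neqA4.
have b3 := b_mem3 x.
have bN := b_notin4 x_gen dimA A6_neq0 A7_eq0 A5_neqA4.
have bxN := bx_notin5 x_gen dimA A6_neq0 A7_eq0 A5_neqA4.
have xb_bx5 := xb_sub_bx_mem5 x_gen dimA A6_neq0 A7_eq0 A5_neqA4.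
have P5 := pow5_line x_gen dimA A6_neq0 A7_eq0 A5_neqA4.
have E6 := pow_dims x_gen dimA A6_neq0 A5_neqA4.
have c5 := pow5_mul0 x_gen dimA A6_neq0 A7_eq0 A5_neqA4.
have cong := mul_x_congr x_gen dimA A6_neq0 A7_eq0 A5_neqA4.
have xa5 := mem_premul_l x a4.
have ax5 := mem_premul_r x a4.
have [xxb xbx] := cong _ _ xb_bx5.
have x2x2 := sqr_mul_sqr x.
split; first exact: gen_basis x_gen dimA A6_neq0 A7_eq0 A5_neqA4.
split; first exact: a4.
split; first by split; [exact: xa5 | exact: ax5 | exact: xb_bx5].
split; split.
- by split; [exact: esym xxb | exact: esym xbx].
- by split; [exact: (c5 x _ ax5).1 | exact: (c5 x _ xa5).1
            | exact: (c5 x _ ax5).2 | exact: (c5 x _ xa5).2].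
- rewrite x2x2 premulDl premulBl (c5 x _ ax5).2 subr0 xbx mulr2n; reflexivity.
- rewrite x2x2 premulDr premulBr (c5 x _ ax5).1 subr0 xxb mulr2n; reflexivity.
- (* The pre-Lie identity for (x, x2, x2), where (x ⋅ x2) ⋅ x2 = 0 because
     x ⋅ x2 ∈ A^4. *)
  have := premul_pre_lie x x2 x2.
  rewrite (pow4_mul_sqr x_gen dimA A6_neq0 A7_eq0 A5_neqA4 a4) sub0r => /eqP.
  by rewrite eq_sym subr_eq addrC -subr_eq opprK eq_sym => /eqP.
- by have [->] := E6.
- by rewrite P5 sqr_mul_bx.
- exact: (quotient_line45 x_gen dimA A6_neq0 A5_neqA4 (mem_premul_r x b3) bxN).
- exact: (quotient_line34 x_gen dimA A6_neq0 A5_neqA4 b3 bN).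
Qed.
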